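(* Let $U\in\mathcal{M}$, $Z\in V^{p\times 2n}$, $R:=UZ^\top\in\mathcal{M}^{\mathrm{spl}}_{2n}$, and let $T_R\mathcal{M}^{\mathrm{spl}}_{2n}$ be the tangent space of $\mathcal{M}^{\mathrm{spl}}_{2n}$ at $R$. Let $S:=Z^\top Z+J_{2n}Z^\top ZJ_{2n}^\top\in\mathbb{R}^{2n\times 2n}$. Then the map $$\Pi:\mathbb{R}^{2N\times p}\longrightarrow T_R\mathcal{M}^{\mathrm{spl}}_{2n},\qquad w\longmapsto (I_{2N}-UU^\top)(wZ+J_{2N}wZJ_{2n}^\top)S^{-1}Z^\top+UU^\top w,$$ is a symplectic projection onto $T_R\mathcal{M}^{\mathrm{spl}}_{2n}$, in the sense that it is a projection and, for every $w\in\mathbb{R}^{2N\times p}$, $$\sum_{j=1}^p\omega_j\big(w-\Pi w,\,y\big)=0,\qquad\forall\,y\in T_R\mathcal{M}^{\mathrm{spl}}_{2n}.$$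
   Context: Let $n\le N$ and $p$ be positive integers. $I_k$ is the $k\times k$ identity and $J_{2m}:=\begin{pmatrix}0&I_m\\-I_m&0\end{pmatrix}\in\mathbb{R}^{2m\times 2m}$. Define $$\mathcal{M}:=\{U\in\mathbb{R}^{2N\times 2n}: U^\top U=I_{2n},\ U^\top J_{2N}U=J_{2n}\},$$ $$V^{p\times 2n}:=\{Z\in\mathbb{R}^{p\times 2n}:\ \mathrm{rank}(Z^\top Z+J_{2n}^\top Z^\top ZJ_{2n})=2n\},$$ $$\mathcal{M}^{\mathrm{spl}}_{2n}:=\{UZ^\top: U\in\mathcal{M},\ Z\in V^{p\times 2n}\}\subset\mathbb{R}^{2N\times p}.$$ The tangent space of $\mathcal{M}^{\mathrm{spl}}_{2n}$ at $R=UZ^\top$ is $$T_{R}\mathcal{M}^{\mathrm{spl}}_{2n}=\{X_UZ^\top+UX_Z^\top:\ X_Z\in\mathbb{R}^{p\times 2n},\ X_U\in\mathbb{R}^{2N\times 2n},\ X_U^\top U=0,\ X_UJ_{2n}=J_{2N}X_U\}.$$ $\omega$ is the canonical symplectic form on $\mathbb{R}^{2N}$, $\omega(u,v)=u^\top J_{2N}v$. For $a,b\in\mathbb{R}^{2N\times p}$ and $1\le j\le p$, $\omega_j(a,b):=\omega(a_j,b_j)$, where $a_j,b_j\in\mathbb{R}^{2N}$ denote the $j$-th columns of $a,b$. *)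

(* Defs.v *)
From HB Require Import structures.
From mathcomp Require Import all_boot all_order all_algebra.
From mathcomp Require Import boolp classical_sets reals.

Set Implicit Arguments.
Unset Strict Implicit.
Unset Printing Implicit Defensive.

Import Order.TTheory GRing.Theory Num.Theory.

Local Open Scope classical_set_scope.
Local Open Scope ring_scope.

(* The dimensions 2n and 2N are written n + n and N + N, so that the block
   decomposition of J_{2m} typechecks. *)
Definition Jmx (R : realType) (m : nat) : 'M[R]_(m + m) :=
  block_mx 0 1%:M (- 1%:M) 0.

Definition orthosympl (R : realType) (N n : nat) : set 'M[R]_(N + N, n + n) :=
  [set U | U^T *m U = 1%:M /\ U^T *m Jmx R N *m U = Jmx R n].

Definition Vset (R : realType) (p n : nat) : set 'M[R]_(p, n + n) :=
  (* %R is needed: the argument of \rank is parsed in %MS, where + is the sum of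
     row spaces. *)
  [set Z | \rank (Z^T *m Z + (Jmx R n)^T *m Z^T *m Z *m Jmx R n)%R
           = (n + n)%N].

Definition Mspl (R : realType) (N p n : nat) : set 'M[R]_(N + N, p) :=
  [set A | exists (U : 'M[R]_(N + N, n + n)) (Z : 'M[R]_(p, n + n)),
     [/\ orthosympl U, Vset Z & A = U *m Z^T]].

(* The tangent space of [Mspl] at U Z^T, in terms of the factors U and Z. *)
Definition tangent_space (R : realType) (N n p : nat)
    (U : 'M[R]_(N + N, n + n)) (Z : 'M[R]_(p, n + n)) :
    set 'M[R]_(N + N, p) :=
  [set y | exists (XU : 'M[R]_(N + N, n + n)) (XZ : 'M[R]_(p, n + n)),
     [/\ XU^T *m U = 0,
         XU *m Jmx R n = Jmx R N *m XU
       & y = XU *m Z^T + U *m XZ^T]].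

Definition omega (R : realType) (N : nat) (u v : 'cV[R]_(N + N)) : R :=
  (u^T *m Jmx R N *m v) 0 0.

Definition omega_col (R : realType) (N p : nat) (j : 'I_p)
    (a b : 'M[R]_(N + N, p)) : R :=
  omega (col j a) (col j b).

Definition Smx (R : realType) (n p : nat) (Z : 'M[R]_(p, n + n)) :
    'M[R]_(n + n) :=
  Z^T *m Z + Jmx R n *m Z^T *m Z *m (Jmx R n)^T.

Definition Pimap (R : realType) (N n p : nat)
    (U : 'M[R]_(N + N, n + n)) (Z : 'M[R]_(p, n + n))
    (w : 'M[R]_(N + N, p)) : 'M[R]_(N + N, p) :=
  (1%:M - U *m U^T) *m (w *m Z + Jmx R N *m w *m Z *m (Jmx R n)^T)
    *m invmx (Smx Z) *m Z^T
  + U *m U^T *m w.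

Definition is_projection_onto (R : realType) (V : lmodType R)
    (f : V -> V) (T : set V) : Prop :=
  [/\ linear f, (forall v, f (f v) = f v) & range f = T].

(* Main.v *)
Require Import Defs.
From HB Require Import structures.
From mathcomp Require Import all_boot all_order all_algebra.
From mathcomp Require Import boolp classical_sets reals.

(** The matrix J is a complex structure, and U, being both orthogonal and
    symplectic, commutes with it ([orthosympl_comm]).  So U and every X_U in
    the tangent space are complex-linear, and the real-linear map

      A |-> A + J A J^T       ([Jsym])

    is twice the projection onto the complex-linear matrices.  In these terms S
    is [Jsym (Z^T Z)], invertible by the rank condition on Z, and
    Pi w = X_U Z^T + U (U^T w) with X_U = (1 - U U^T) Jsym(w Z) S^-1.

    Projection.  The three factors of X_U are complex-linear, so Pi w is tangent.
    Conversely, if y = X_U Z^T + U X_Z^T is tangent, the factor 1 - U U^T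
    cancels the second summand, and since [Jsym] commutes with left
    multiplication by complex-linear matrices, (1 - U U^T) Jsym(y Z) = X_U Jsym(Z^T Z) = X_U S
    ([tangent_horizontal]).  Hence Pi y = y.

    Symplectic orthogonality.  Let d = w - Pi w.  Then U^T d = 0, and the
    previous identity applied to Pi w gives (1 - U U^T) Jsym(d Z) = 0.
    Together these say that Jsym(d Z) = 0, that is, d Z is complex-antilinear.
    Now sum_j omega_j(d, y) = tr(d^T J y).  The U X_Z^T part of y contributes
    nothing since U^T d = 0, and the X_U Z^T part contributes
    tr((d Z)^T J X_U), which vanishes because complex-antilinear matrices are
    orthogonal to complex-linear ones ([Jsym_eq0_trace]). *)

Set Implicit Arguments.
Unset Strict Implicit.
Unset Printing Implicit Defensive.

Import Order.TTheory GRing.Theory Num.Theory.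

Local Open Scope classical_set_scope.
Local Open Scope ring_scope.

Lemma trmx_Jmx (R : realType) m : (Jmx R m)^T = - Jmx R m.
Proof.
by rewrite /Jmx tr_block_mx !trmx0 linearN /= !trmx1 opp_block_mx !oppr0 opprK.
Qed.

Lemma mulmx_JJ (R : realType) m : Jmx R m *m Jmx R m = - 1%:M.
Proof.
rewrite /Jmx mulmx_block !mul0mx !mulmx0 !mulmx1 !mul1mx !addr0 !add0r.
by rewrite (scalar_mx_block m m 1) opp_block_mx !oppr0.
Qed.

Lemma gram_eq0 (R : realType) m n (A : 'M[R]_(m, n)) : A^T *m A = 0 -> A = 0.
Proof.
move=> A0; apply/matrixP => i j; rewrite mxE; apply/eqP.
have := congr1 (fun B : 'M_n => B j j) A0; rewrite !mxE => /eqP.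
rewrite psumr_eq0 => [/allP/(_ i (mem_index_enum _))|k _].
  by rewrite mxE mulf_eq0 orbb.
by rewrite mxE -expr2 sqr_ge0.
Qed.

(** The Gram matrix of J U - U J expands to 1 - 1 - 1 + 1. *)
Lemma orthosympl_comm (R : realType) N n (U : 'M[R]_(N + N, n + n)) :
  orthosympl U -> U *m Jmx R n = Jmx R N *m U.
Proof.
case=> UtU UtJU; apply/eqP; rewrite -subr_eq0; apply/eqP/gram_eq0.
rewrite [X in X *m _]linearB /= !trmx_mul !trmx_Jmx.
rewrite mulmxBl !mulmxBr !mulNmx !mulmxN !mulNmx.
have -> : Jmx R n *m U^T *m (U *m Jmx R n) = - 1%:M.
  by rewrite mulmxA -(mulmxA (Jmx R n)) UtU mulmx1 mulmx_JJ.
have -> : Jmx R n *m U^T *m (Jmx R N *m U) = - 1%:M.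
  by rewrite -!mulmxA (mulmxA U^T) UtJU mulmx_JJ.
have -> : U^T *m Jmx R N *m (U *m Jmx R n) = - 1%:M.
  by rewrite mulmxA UtJU mulmx_JJ.
have -> : U^T *m Jmx R N *m (Jmx R N *m U) = - 1%:M.
  by rewrite mulmxA -(mulmxA U^T) mulmx_JJ mulmxN mulmx1 mulNmx UtU.
by rewrite !opprK subrr.
Qed.

(** Twice the complex-linear part of A; the factor 2 is kept so that S is
    exactly [Jsym (Z^T *m Z)]. *)
Definition Jsym (R : realType) N n (A : 'M[R]_(N + N, n + n)) :=
  A + Jmx R N *m A *m (Jmx R n)^T.

Lemma Jsym_is_linear (R : realType) N n : linear (@Jsym R N n).
Proof.
move=> a A B; rewrite /Jsym mulmxDr mulmxDl -scalemxAr -scalemxAl scalerDr.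
by rewrite addrACA.
Qed.

HB.instance Definition _ (R : realType) N n :=
  GRing.isLinear.Build R _ _ _ (@Jsym R N n) (@Jsym_is_linear R N n).

Lemma Jsym_comm (R : realType) N n (A : 'M[R]_(N + N, n + n)) :
  Jsym A *m Jmx R n = Jmx R N *m Jsym A.
Proof.
rewrite /Jsym trmx_Jmx mulmxDl mulmxDr !mulmxN !mulNmx.
rewrite -(mulmxA _ (Jmx R n)) !mulmxA !mulmx_JJ !mulNmx !mul1mx.
by rewrite -mulmxA mulmx_JJ mulmxN mulmx1 !opprK addrC.
Qed.

Lemma Jsym_mul (R : realType) M N n (X : 'M[R]_(M + M, N + N))
    (A : 'M[R]_(N + N, n + n)) :
  X *m Jmx R N = Jmx R M *m X -> Jsym (X *m A) = X *m Jsym A.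
Proof. by move=> XJ; rewrite /Jsym mulmxDr !mulmxA -XJ. Qed.

(** Conjugating both factors of the trace by the orthogonal matrix J preserves
    it; but it fixes J X and, by hypothesis, negates A. *)
Lemma Jsym_eq0_trace (R : realType) N n (A X : 'M[R]_(N + N, n + n)) :
  Jsym A = 0 -> X *m Jmx R n = Jmx R N *m X -> \tr (A^T *m Jmx R N *m X) = 0.
Proof.
move=> /eqP; rewrite addr_eq0 => /eqP A_anti XJ; apply/eqP.
have At : A^T = - (Jmx R n *m A^T *m (Jmx R N)^T).
  by rewrite {1}A_anti [LHS]linearN /= !trmx_mul trmxK mulmxA.
have : \tr (A^T *m Jmx R N *m X) = - \tr (A^T *m Jmx R N *m X).
  rewrite {1}At trmx_Jmx mulmxN opprK -(mulmxA _ (Jmx R N) (Jmx R N)) mulmx_JJ.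
  rewrite mulmxN mulmx1 mulNmx [LHS]linearN /= -mulmxA mxtrace_mulC.
  by rewrite (mulmxA X) XJ mxtrace_mulC.
by move/eqP; rewrite -addr_eq0 -mulr2n mulrn_eq0.
Qed.

Lemma SmxE (R : realType) n p (Z : 'M[R]_(p, n + n)) :
  Smx Z = Jsym (Z^T *m Z).
Proof. by rewrite /Smx /Jsym !mulmxA. Qed.

(** Replacing J by J^T = - J turns S into the matrix whose rank defines V,
    without changing it. *)
Lemma Smx_unit (R : realType) n p (Z : 'M[R]_(p, n + n)) :
  Vset Z -> Smx Z \in unitmx.
Proof.
rewrite /Vset /= -row_free_unit /row_free => rkS; apply/eqP.
by rewrite -[RHS]rkS /Smx trmx_Jmx !mulNmx mulmxN.
Qed.

Lemma PimapE (R : realType) N n p (U : 'M[R]_(N + N, n + n))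
    (Z : 'M[R]_(p, n + n)) (w : 'M[R]_(N + N, p)) :
  Pimap U Z w =
  (1%:M - U *m U^T) *m Jsym (w *m Z) *m invmx (Smx Z) *m Z^T + U *m U^T *m w.
Proof. by rewrite /Pimap /Jsym !mulmxA. Qed.

Lemma Pimap_is_linear (R : realType) N n p (U : 'M[R]_(N + N, n + n))
    (Z : 'M[R]_(p, n + n)) : linear (@Pimap R N n p U Z).
Proof.
move=> a v w; rewrite !PimapE (mulmxDl (a *: v)) -scalemxAl linearP /=.
move: (Jsym (v *m Z)) (Jsym (w *m Z)) (1%:M - _) => E F P.
rewrite !(mulmxDl, mulmxDr) -!scalemxAr -!scalemxAl.
by rewrite scalerDr addrACA.
Qed.

Lemma sum_omega_col (R : realType) N p (a b : 'M[R]_(N + N, p)) :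
  \sum_(j < p) omega_col j a b = \tr (a^T *m Jmx R N *m b).
Proof.
apply: eq_bigr => j _; rewrite /omega_col /omega tr_col -row_mul.
by rewrite !mxE; apply: eq_bigr => i _; rewrite !mxE.
Qed.

Section OrthosymplecticFrame.

Variables (R : realType) (N n p : nat).
Variables (U : 'M[R]_(N + N, n + n)) (Z : 'M[R]_(p, n + n)).
Hypothesis hU : orthosympl U.
Hypothesis hZ : Vset Z.

Local Notation P := (1%:M - U *m U^T).

Lemma tr_orthosympl_comm : U^T *m Jmx R N = Jmx R n *m U^T.
Proof.
have /(congr1 trmx) := orthosympl_comm hU.
by rewrite !trmx_mul !trmx_Jmx mulNmx mulmxN => /oppr_inj.
Qed.

Lemma normal_proj_comm : P *m Jmx R N = Jmx R N *m P.
Proof.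
rewrite mulmxBl mulmxBr mulmx1 mul1mx -mulmxA tr_orthosympl_comm.
by rewrite !mulmxA orthosympl_comm.
Qed.

Lemma normal_projU : P *m U = 0.
Proof. by case: hU => UtU _; rewrite mulmxBl mul1mx -mulmxA UtU mulmx1 subrr. Qed.

Lemma tr_normal_proj : U^T *m P = 0.
Proof. by case: hU => UtU _; rewrite mulmxBr mulmx1 mulmxA UtU mul1mx subrr. Qed.

Lemma normal_proj_id m (X : 'M_(N + N, m)) : U^T *m X = 0 -> P *m X = X.
Proof. by move=> UtX; rewrite mulmxBl mul1mx -mulmxA UtX mulmx0 subr0. Qed.

Local Notation XU w := (P *m Jsym (w *m Z) *m invmx (Smx Z)).

Lemma horizontal_orth w : (XU w)^T *m U = 0.
Proof.
apply: trmx_inj; rewrite trmx_mul trmxK trmx0 !mulmxA.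
by rewrite tr_normal_proj !mul0mx.
Qed.

Lemma horizontal_comm w : XU w *m Jmx R n = Jmx R N *m XU w.
Proof.
have S_unit := Smx_unit hZ.
have SJ : invmx (Smx Z) *m Jmx R n = Jmx R n *m invmx (Smx Z).
  apply: (can_inj (mulKmx S_unit)).
  by rewrite mulKVmx // mulmxA SmxE Jsym_comm -SmxE mulmxK.
rewrite -mulmxA SJ mulmxA -(mulmxA P) Jsym_comm !mulmxA.
by rewrite normal_proj_comm.
Qed.

Lemma Pimap_split w : Pimap U Z w = XU w *m Z^T + U *m (w^T *m U)^T.
Proof. by rewrite PimapE trmx_mul trmxK !mulmxA. Qed.

Lemma Pimap_tangent w : tangent_space U Z (Pimap U Z w).
Proof.
exists (XU w), (w^T *m U).
by split; [exact: horizontal_orth | exact: horizontal_comm | exact: Pimap_split].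
Qed.

(** This recovers the factor X_U from a tangent vector; it is what forces the
    matrix S^-1 in the formula for the projection. *)
Lemma tangent_horizontal (A : 'M_(N + N, n + n)) (B : 'M_(p, n + n)) :
  A^T *m U = 0 -> A *m Jmx R n = Jmx R N *m A ->
  P *m Jsym ((A *m Z^T + U *m B^T) *m Z) = A *m Smx Z.
Proof.
move=> AtU AJ; rewrite (mulmxDl (A *m _)) -!mulmxA [Jsym _]linearD /=.
rewrite !Jsym_mul //; last exact: orthosympl_comm.
rewrite mulmxDr !mulmxA normal_projU mul0mx addr0 normal_proj_id ?SmxE //.
by apply: trmx_inj; rewrite trmx_mul trmxK trmx0.
Qed.

Lemma Pimap_id y : tangent_space U Z y -> Pimap U Z y = y.
Proof.
case=> A [B [AtU AJ ->]].
rewrite PimapE tangent_horizontal // mulmxK ?Smx_unit //.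
have UtA : U^T *m A = 0 by apply: trmx_inj; rewrite trmx_mul trmxK trmx0.
have UtU : U^T *m U = 1%:M by case: hU.
congr (_ + _); rewrite -mulmxA mulmxDr !mulmxA UtA UtU.
by rewrite mul0mx add0r mul1mx.
Qed.

Lemma tr_residual w : U^T *m (w - Pimap U Z w) = 0.
Proof.
case: hU => UtU _; rewrite PimapE mulmxBr mulmxDr !mulmxA.
by rewrite tr_normal_proj UtU !mul0mx add0r mul1mx subrr.
Qed.

(** Reading the X_U factor of the tangent vector Pi w through
    [tangent_horizontal] shows that w and Pi w have the same
    P Jsym(_ Z).  Nothing is lost by applying P to the residual: its columns
    are orthogonal to the range of U, and this orthogonal complement is
    J-stable. *)
Lemma residual_antilinear w : Jsym ((w - Pimap U Z w) *m Z) = 0.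
Proof.
set d := w - _.
have Ud : U^T *m d = 0 := tr_residual w.
have <- : P *m Jsym (d *m Z) = Jsym (d *m Z).
  apply: normal_proj_id; rewrite /Jsym mulmxDr !mulmxA Ud tr_orthosympl_comm.
  by rewrite -(mulmxA (Jmx R n)) Ud mulmx0 !mul0mx addr0.
rewrite (mulmxBl w) [Jsym _]linearB /= mulmxBr Pimap_split tangent_horizontal.
- by rewrite mulmxKV ?Smx_unit // subrr.
- exact: horizontal_orth.
- exact: horizontal_comm.
Qed.

End OrthosymplecticFrame.

Theorem proposition4p3 (R : realType) (N n p : nat)
    (n_gt0 : (0 < n)%N) (p_gt0 : (0 < p)%N) (le_nN : (n <= N)%N)
    (U : 'M[R]_(N + N, n + n)) (Z : 'M[R]_(p, n + n))
    (hU : orthosympl U) (hZ : Vset Z) :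
  [/\ Mspl n (U *m Z^T),
      Smx Z \in unitmx,
      is_projection_onto (Pimap U Z) (tangent_space U Z)
    & forall w y : 'M[R]_(N + N, p), tangent_space U Z y ->
        \sum_(j < p) omega_col j (w - Pimap U Z w) y = 0].
Proof.
split.
- by exists U, Z.
- exact: Smx_unit.
- split; first exact: Pimap_is_linear.
  + by move=> v; rewrite Pimap_id //; apply: Pimap_tangent.
  + apply/seteqP; split => [_ [w _ <-]|y Ty]; first exact: Pimap_tangent.
    by exists y => //; apply: Pimap_id.
- move=> w _ [A [B [_ AJ ->]]]; rewrite sum_omega_col.
  have dZ := residual_antilinear hU hZ w; have Ud := tr_residual Z hU w.
  set d := w - _ in dZ Ud *.
  have dtU : d^T *m U = 0 by apply: trmx_inj; rewrite trmx_mul trmxK trmx0.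
  (* J U = U J, so the vertical part of y pairs with d through d^T U = 0. *)
  rewrite mulmxDr (mulmxA _ U) -(mulmxA _ _ U) -(orthosympl_comm hU).
  rewrite (mulmxA _ U) dtU !mul0mx addr0 mulmxA mxtrace_mulC !mulmxA.
  by rewrite -trmx_mul Jsym_eq0_trace.
Qed.
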